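(* Let $p \geq 0$ be an integer, $\rho>0$, $c\in\mathbb{R}^3$, and let $f:\bar B(c,\rho)\to\mathbb{C}$ be harmonic in $B(c,\rho)$ and continuous on $\bar B(c,\rho)$. Then the $p$-th order local expansion $\mathcal{L}_c^p[f]$ of $f$ centered at $c$ satisfies $$\left\|\mathcal{L}_c^p[f]\right\|_\infty \leq \Lambda_p \|f\|_\infty,$$ where both norms are supremum norms over $\bar B(c,\rho)$ and $\Lambda_p$ is the Lebesgue constant of the order-$p$ Fourier--Laplace projection on $\mathbb{S}^2$.
   Context: $|\cdot|$ is the Euclidean norm on $\mathbb{R}^3$; for $x \neq 0$, $\hat{x} = x/|x|$; $\mathbb{S}^2$ is the unit sphere in $\mathbb{R}^3$ with surface measure $dS$; $B(c,\rho)$ and $\bar B(c,\rho)$ are the open and closed Euclidean balls. Spherical harmonics: for integers $n \geq 0$, $-n \leq m \leq n$, and $\xi = (\sin\theta\cos\varphi, \sin\theta\sin\varphi, \cos\theta)\in\mathbb{S}^2$, $$Y_n^m(\xi) = \sqrt{\frac{2n+1}{4\pi}\frac{(n-m)!}{(n+m)!}}\, e^{im\varphi} P_n^m(\cos\theta),$$ where $P_n^m$ is the associated Legendre function of degree $n$ and order $m$ (with the usual convention for negative order $P_n^{-m} = (-1)^m \frac{(n-m)!}{(n+m)!}P_n^m$). They form an orthonormal basis of $L^2(\mathbb{S}^2)$ with inner product $(f,g)_{\mathbb{S}^2}=\int_{\mathbb{S}^2} f\overline{g}\,dS$. Regular solid harmonics: $R_n^m(x) = |x|^n Y_n^m(\hat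 x)$ (with $R_n^m(0)=0$ for $n>0$ and $R_0^0 \equiv 1/\sqrt{4\pi}$). Local expansion: with $f$ as in the claim, the local coefficients are $L_n^m = \rho^{-n}\int_{\mathbb{S}^2} f(c+\rho\xi)\overline{Y_n^m(\xi)}\,dS(\xi)$, and $$\mathcal{L}_c^p[f](x) = \sum_{n=0}^p\sum_{m=-n}^n L_n^m R_n^m(x-c),\quad x\in\bar B(c,\rho).$$ Fourier--Laplace projection: for $g\in L^2(\mathbb{S}^2)$, $\mathcal{F}_p[g](\xi) = \sum_{n=0}^p\sum_{m=-n}^n (g,Y_n^m)_{\mathbb{S}^2}Y_n^m(\xi)$. For each $p$, $\Lambda_p>0$ denotes the operator norm of $\mathcal{F}_p$ on $C(\mathbb{S}^2)$ with the supremum norm, so that $\|\mathcal{F}_p g\|_\infty\le\Lambda_p\|g\|_\infty$ for all continuous $g:\mathbb{S}^2\to\mathbb{C}$. It equals the $L^1$ norm $\int_{\mathbb{S}^2}\left|\sum_{n=0}^p\frac{2n+1}{4\pi}P_n(\xi\cdot x)\right|dS(\xi)$ (independent of $x\in\mathbb{S}^2$; $P_n$ is the Legendre polynomial), and it is known that $\Lambda_p = \sqrt{8p/\pi}+o(\sqrt p)$ as $p\to\infty$. *)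

(* Defs.v *)
From HB Require Import structures.
From mathcomp Require Import all_boot all_order all_algebra.
From mathcomp Require Import complex.
From mathcomp Require Import all_classical all_reals all_analysis.

Set Implicit Arguments.
Unset Strict Implicit.
Unset Printing Implicit Defensive.

Import Order.TTheory GRing.Theory Num.Theory.
Import numFieldNormedType.Exports.

Local Open Scope classical_set_scope.
Local Open Scope ring_scope.

(* The cast gives [R[i]] the topology of its modulus, which is how continuity
   of complex-valued functions is understood below. *)
Notation Cplx R := (R[i] : numFieldType).

Section Euclidean.
Variable R : realType.
Implicit Types (x c : 'rV[R]_3) (r : R).

(* The library norm on ['rV[R]_3] is the max norm; it induces the same topology
   as the Euclidean norm. *)
Definition enorm x : R := Num.sqrt (\sum_i x 0 i ^+ 2).

Definition eball c r : set 'rV[R]_3 := [set x | enorm (x - c) < r].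

Definition ecball c r : set 'rV[R]_3 := [set x | enorm (x - c) <= r].

Definition sphere2 : set 'rV[R]_3 := [set x | enorm x = 1].

End Euclidean.

Section Harmonic.
Variable R : realType.
Implicit Types (u : 'rV[R]_3 -> R) (U : set 'rV[R]_3).

Definition partial (i : 'I_3) u : 'rV[R]_3 -> R :=
  fun x => 'D_(delta_mx 0 i) u x.

Definition C1_on U u : Prop :=
  forall i : 'I_3, forall x, U x ->
    derivable u x (delta_mx 0 i) /\ {for x, continuous (partial i u)}.

Definition C2_on U u : Prop :=
  C1_on U u /\ forall i : 'I_3, C1_on U (partial i u).

Definition laplacian u : 'rV[R]_3 -> R :=
  fun x => \sum_i partial i (partial i u) x.

Definition harmonic_on U (f : 'rV[R]_3 -> Cplx R) : Prop :=
  [/\ C2_on U (fun x => complex.Re (f x)),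
      C2_on U (fun x => complex.Im (f x)),
      forall x, U x -> laplacian (fun y => complex.Re (f y)) x = 0
    & forall x, U x -> laplacian (fun y => complex.Im (f y)) x = 0].

End Harmonic.

Section SurfaceIntegral.
Variable R : realType.

Definition spherical (theta phi : R) : 'rV[R]_3 :=
  \row_(i < 3) [:: sin theta * cos phi; sin theta * sin phi; cos theta]`_i.

(* Integral for the surface measure dS = sin theta dtheta dphi. *)
Definition sphere_integralR (h : 'rV[R]_3 -> R) : R :=
  Rintegral (lebesgue_measure \x lebesgue_measure)%E
    (`[0, pi] `*` `[0, 2 * pi])
    (fun a : measurableTypeR R * measurableTypeR R =>
       h (spherical a.1 a.2) * sin a.1).

Definition sphere_integral (h : 'rV[R]_3 -> Cplx R) : Cplx R :=
  (sphere_integralR (fun xi => complex.Re (h xi)) +i*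
   sphere_integralR (fun xi => complex.Im (h xi)))%C.

End SurfaceIntegral.

Section SphericalHarmonics.
Variable R : realType.

(* Rodrigues' formula. *)
Definition legendre (n : nat) : {poly R} :=
  (2 ^+ n * n`!%:R)^-1 *: (('X ^+ 2 - 1) ^+ n)^`(n).

(* With the Condon-Shortley phase, which cancels in the products of
   [sph_harmonic n m] with the conjugate of [sph_harmonic n m] below. *)
Definition assoc_legendre_nneg (n k : nat) (t : R) : R :=
  (-1) ^+ k * Num.sqrt (1 - t ^+ 2) ^+ k * ((legendre n)^`(k)).[t].

Definition assoc_legendre (n : nat) (m : int) (t : R) : R :=
  if m is Negz j then
    (* order [- j.+1] *)
    (-1) ^+ j.+1 * ((n - j.+1)`!%:R / (n + j.+1)`!%:R)
      * assoc_legendre_nneg n j.+1 t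
  else assoc_legendre_nneg n (absz m) t.

(* [absz] is harmless: the orders satisfy -n <= m <= n. *)
Definition harmonic_angles (n : nat) (m : int) (theta phi : R) : Cplx R :=
  (Num.sqrt ((2 * n + 1)%:R / (4 * pi)
             * ((absz (n%:Z - m))`!%:R / (absz (n%:Z + m))`!%:R)))%:C%C
  * (cos (m%:~R * phi) +i* sin (m%:~R * phi))%C
  * (assoc_legendre n m (cos theta))%:C%C.

Definition polar_angle (xi : 'rV[R]_3) : R := acos (xi 0 2).

(* At the poles this is [pi / 2]; the value there is immaterial, since
   P_n^m (1) = P_n^m (-1) = 0 unless m = 0. *)
Definition azimuth (xi : 'rV[R]_3) : R :=
  let a := acos (xi 0 0 / Num.sqrt (xi 0 0 ^+ 2 + xi 0 1 ^+ 2)) in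
  if 0 <= xi 0 1 then a else - a.

Lemma sphericalK (xi : 'rV[R]_3) :
  sphere2 xi -> spherical (polar_angle xi) (azimuth xi) = xi.
Proof.
rewrite /sphere2 /= /enorm => h.
have /(congr1 (fun x => x ^+2)) := h.
rewrite sqr_sqrtr ?sumr_ge0 // => [|i _]; last exact: sqr_ge0.
rewrite !big_ord_recl big_ord0 /= expr1n addr0.
set x := xi 0 ord0; rewrite (_ : lift _ _ = 1 :> 'I_3); last exact: val_inj.
rewrite (_ : lift _ _ = 2 :> 'I_3); last exact: val_inj.
set y := xi 0 1; set z := xi 0 2 => e.
have x0 := sqr_ge0 x; have y0 := sqr_ge0 y; have z0 := sqr_ge0 z.
have zr : -1 <= z <= 1 by rewrite -ler_norml -(@ler_pXn2r _ 2) ?nnegrE // expr1n real_normK ?num_real // -e addrA lerDr addr_ge0.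
have ct : cos (polar_angle xi) = z by rewrite /polar_angle acosK // in_itv.
have st : sin (polar_angle xi) = Num.sqrt (x ^+2 + y^+2).
  by rewrite /polar_angle sin_acos // -/z; congr Num.sqrt; rewrite -e addrA addrK.
set s := Num.sqrt _ in st.
have s0 : 0 <= s := sqrtr_ge0 _.
have s2 : s ^+2 = x^+2+y^+2 by rewrite sqr_sqrtr // addr_ge0.
have K : s * cos (azimuth xi) = x /\ s * sin (azimuth xi) = y.
  have [sz|snz] := eqVneq s 0.
    move: s2; rewrite sz expr0n /= => /esym/eqP; rewrite paddr_eq0 // !sqrf_eq0 => /andP[/eqP -> /eqP ->].
    by rewrite !mul0r.
  have sp : 0 < s by rewrite lt_def snz.
  have xr : -1 <= x / s <= 1.
    by rewrite -ler_norml -(@ler_pXn2r _ 2) ?nnegrE // expr1n real_normK ?num_real // expr_div_n ler_pdivrMr ?exprn_gt0 // mul1r s2 lerDl.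
  have sa : s * sin (acos (x / s)) = `|y|.
    rewrite sin_acos // -{1}(gtr0_norm sp) -sqrtr_sqr -sqrtrM ?sqr_ge0 // mulrBr mulr1 expr_div_n mulrCA divff ?sqrf_eq0 // mulr1 s2 addrC addKr.
    by rewrite sqrtr_sqr.
  rewrite /azimuth -/x -/y -/s.
  case: ifPn => [yp|]; last rewrite -ltNge => yn; rewrite ?cosN ?sinN ?mulrN sa.
    by rewrite ger0_norm // acosK ?in_itv // mulrCA divff ?mulr1.
  by rewrite ltr0_norm // opprK acosK ?in_itv // mulrCA divff ?mulr1.
apply/rowP => i; rewrite mxE st ct.
case: K => K1 K2; rewrite K1 K2.
case: i => [[|[|[|//]]] hi] /=; [rewrite /x|rewrite /y|rewrite /z]; congr (xi _ _); exact: val_inj.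
Qed.

Definition sph_harmonic (n : nat) (m : int) (xi : 'rV[R]_3) : Cplx R :=
  harmonic_angles n m (polar_angle xi) (azimuth xi).

(* At [x = 0] this is 0 for n > 0, and 1 / sqrt (4 pi) for n = 0 because
   [sph_harmonic 0 0] is constant. *)
Definition solid_harmonic (n : nat) (m : int) (x : 'rV[R]_3) : Cplx R :=
  (enorm x ^+ n)%:C%C * sph_harmonic n m ((enorm x)^-1 *: x).

(* Sum over 0 <= n <= p and -n <= m <= n, with m = k - n. *)
Definition degree_order_sum (p : nat) (F : nat -> int -> Cplx R) : Cplx R :=
  \sum_(n < p.+1) \sum_(k < n.*2.+1) F n (k%:Z - n%:Z).

Definition fourier_coef (g : 'rV[R]_3 -> Cplx R) (n : nat) (m : int) : Cplx R :=
  sphere_integral (fun xi => g xi * conjc (sph_harmonic n m xi)).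

Definition fourier_laplace (p : nat) (g : 'rV[R]_3 -> Cplx R)
    (xi : 'rV[R]_3) : Cplx R :=
  degree_order_sum p (fun n m => fourier_coef g n m * sph_harmonic n m xi).

Definition local_coef (c : 'rV[R]_3) (rho : R) (f : 'rV[R]_3 -> Cplx R)
    (n : nat) (m : int) : Cplx R :=
  (rho ^- n)%:C%C
  * sphere_integral (fun xi => f (c + rho *: xi) * conjc (sph_harmonic n m xi)).

Definition local_expansion (p : nat) (c : 'rV[R]_3) (rho : R)
    (f : 'rV[R]_3 -> Cplx R) (x : 'rV[R]_3) : Cplx R :=
  degree_order_sum p
    (fun n m => local_coef c rho f n m * solid_harmonic n m (x - c)).

Definition supnorm (A : set 'rV[R]_3) (g : 'rV[R]_3 -> Cplx R) : R :=
  sup [set Normc.normc (g x) | x in A].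

(* Operator norm of [fourier_laplace p] on C(S^2) with the supremum norm. *)
Definition lebesgue_constant (p : nat) : R :=
  sup [set supnorm (@sphere2 R) (fourier_laplace p g) |
       g in [set g : 'rV[R]_3 -> Cplx R |
             {within @sphere2 R, continuous g}
             /\ supnorm (@sphere2 R) g <= 1]].

End SphericalHarmonics.

(* Main.v *)
Require Import Defs.
From mathcomp Require Import all_boot all_order all_algebra.
From mathcomp Require Import complex ring lra zify.
From mathcomp Require Import all_classical all_reals all_analysis.
Import Order.TTheory GRing.Theory Num.Theory.
Import numFieldNormedType.Exports.
Local Open Scope classical_set_scope.
Local Open Scope ring_scope.

Set Implicit Arguments.
Unset Strict Implicit.
Unset Printing Implicit Defensive.

(** Put u(y) = L(c + y), where L is the local expansion.  On the sphere
    |y| = rho the factors rho^-n of the local coefficients cancel the factors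
    |y|^n of the solid harmonics, so u restricted to that sphere is the
    Fourier-Laplace projection of xi |-> f (c + rho xi)
    ([local_expansion_sphere]) and is bounded there by the Lebesgue constant
    times the supremum of |f| ([fourier_laplace_le_lebesgue]).  Since u is a
    harmonic polynomial, the maximum principle extends the bound to the ball.

    Two points need an argument.

    Harmonicity.  With w = x_0 + i x_1, the quadratic polynomial
      A_x(X) = - conj(w) / 2 + x_2 X + (w / 2) X^2
    is linear in x, and the sum over the axes of A_(e_i) ^ 2 is 0: it is the
    pairing of x with a null vector depending on X.  Hence x |-> A_x(X)^n is
    harmonic, and so is each coefficient of A_x ^ n in X.  On the unit sphere,
      2 w A_x(X) = (x_2 + w X)^2 - 1,
    so that the Taylor expansion of (t^2 - 1)^n at x_2 and Rodrigues' formula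
    identify the coefficient of X^(n + k) with a multiple of
    w^k P_n^(k)(x_2), that is, of Y_n^k ([coef_null_quad_legendre],
    [harmonic_angles_solid]); conjugating w gives the negative orders.  By
    homogeneity the solid harmonics are these coefficients on the whole space
    ([solid_harmonic_solid]).

    Maximum principle.  For these polynomials it is enough to look at the
    restrictions to the lines parallel to the axes: harmonicity says that the
    coefficients of t^2 of the three restrictions add up to 0
    ([axes_harmonic]).  At an interior maximum of |u|^2 + e |x|^2 these
    coefficients would all be nonpositive, whereas their sum is at least 3 e
    ([maximum_principle]).

    Finally, the Lebesgue constant being defined as a supremum, one must know
    that the projections of the functions bounded by 1 are uniformly bounded,
    and that the projection commutes with the scaling that normalizes f.
    Both follow from estimates and homogeneity of the integral that hold
    without measurability of the integrand. *)

(** * Moduli of complex numbers and Euclidean norms *)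

Section Preliminaries.
Variable R : realType.
Implicit Types (x c : 'rV[R]_3) (u v : 'rV[R]_3 -> R[i]) (t : R).

Lemma Re_sum I (r : seq I) (F : I -> R[i]) :
  complex.Re (\sum_(i <- r) F i) = \sum_(i <- r) complex.Re (F i).
Proof. by apply: big_morph => [[a b] [c d]|]. Qed.

Lemma Im_sum I (r : seq I) (F : I -> R[i]) :
  complex.Im (\sum_(i <- r) F i) = \sum_(i <- r) complex.Im (F i).
Proof. by apply: big_morph => [[a b] [c d]|]. Qed.

Lemma Re_mul_real (z : R[i]) (t : R) :
  complex.Re (z * t%:C%C) = complex.Re z * t.
Proof. by case: z => a b /=; rewrite mulr0 subr0. Qed.

Lemma Im_mul_real (z : R[i]) (t : R) :
  complex.Im (z * t%:C%C) = complex.Im z * t.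
Proof. by case: z => a b /=; rewrite mulr0 add0r. Qed.

Lemma normc2 (z : R[i]) :
  Normc.normc z ^+ 2 = complex.Re z ^+ 2 + complex.Im z ^+ 2.
Proof. by case: z => a b /=; rewrite sqr_sqrtr // addr_ge0 // sqr_ge0. Qed.

Lemma normc_ge0 (z : R[i]) : 0 <= Normc.normc z.
Proof. by case: z => a b /=; rewrite sqrtr_ge0. Qed.

Lemma normr_Re_le (z : R[i]) : `|complex.Re z| <= Normc.normc z.
Proof.
rewrite -(@ler_pXn2r _ 2) ?nnegrE ?normc_ge0 // normc2.
by rewrite real_normK ?num_real // lerDl sqr_ge0.
Qed.

Lemma normr_Im_le (z : R[i]) : `|complex.Im z| <= Normc.normc z.
Proof.
rewrite -(@ler_pXn2r _ 2) ?nnegrE ?normc_ge0 // normc2.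
by rewrite real_normK ?num_real // lerDr sqr_ge0.
Qed.

Lemma normc_le_ReIm (z : R[i]) :
  Normc.normc z <= `|complex.Re z| + `|complex.Im z|.
Proof.
rewrite -(@ler_pXn2r _ 2) ?nnegrE ?normc_ge0 ?addr_ge0 // normc2 sqrrD.
by rewrite !real_normK ?num_real // lerD2r lerDl mulrn_wge0 // mulr_ge0.
Qed.

Lemma normc_conjc (z : R[i]) : Normc.normc (z^*)%C = Normc.normc z.
Proof. by case: z => a b /=; rewrite sqrrN. Qed.

Lemma normcD_le (z w : R[i]) :
  Normc.normc (z + w) <= Normc.normc z + Normc.normc w.
Proof. exact: le_normcD. Qed.

Lemma normcB_sym (z w : R[i]) : Normc.normc (z - w) = Normc.normc (w - z).
Proof. by rewrite -opprB; exact: normcN. Qed.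

Lemma normc_sum_le I (r : seq I) (F : I -> R[i]) (B : I -> R) :
  (forall i, Normc.normc (F i) <= B i) ->
  Normc.normc (\sum_(i <- r) F i) <= \sum_(i <- r) B i.
Proof.
move=> FB; elim: r => [|i r IH]; first by rewrite !big_nil Normc.normc0.
rewrite !big_cons; apply: le_trans (normcD_le _ _) _.
exact: lerD.
Qed.

Lemma continuous_normc : continuous (fun z : Cplx R => Normc.normc z : R).
Proof.
move=> z; have FF : Filter (nbhs z) by apply: nbhs_filter.
apply: (proj2 (@cvgrPdist_lt _ _ _ _ FF _ _)) => e e0; apply/nbhs_ballP.
have eC0 : 0 < (e%:C)%C :> R[i] by rewrite ltcR.
exists (e%:C)%C => // w; rewrite -ball_normE /= => zw.
have {}zw : Normc.normc (z - w) < e by rewrite -ltcR.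
apply: le_lt_trans zw; rewrite ler_norml; apply/andP; split.
  have := normcD_le (w - z) z.
  by rewrite subrK normcB_sym; lra.
by have := normcD_le (z - w) w; rewrite subrK; lra.
Qed.

Lemma enorm2 x : enorm x ^+ 2 = \sum_i x 0 i ^+ 2.
Proof. by rewrite sqr_sqrtr // sumr_ge0 // => i _; apply: sqr_ge0. Qed.

Lemma enorm_ge0 x : 0 <= enorm x. Proof. exact: sqrtr_ge0. Qed.

Lemma continuous_enorm : continuous (@enorm R).
Proof.
have csq : continuous (fun x : 'rV[R]_3 => \sum_i x 0 i ^+ 2).
  apply: continuous_big => [|i _ x]; first exact: add_continuous.
  have cx : (fun y : 'rV[R]_3 => y 0 i) @ x --> x 0 i.
    by apply: coord_continuous.
  exact: (cvgM cx cx).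
move=> x; apply: (@continuous_comp _ _ _ _ (@Num.sqrt R)) (csq x) _.
exact: sqrt_continuous.
Qed.

Lemma coord_le_enorm x i : `|x 0 i| <= enorm x.
Proof.
rewrite -(@ler_pXn2r _ 2) ?nnegrE ?enorm_ge0 // enorm2 real_normK ?num_real //.
by rewrite (bigD1 i) //= lerDl sumr_ge0 // => j _; apply: sqr_ge0.
Qed.

Lemma closed_ecball c (r : R) : closed (ecball c r).
Proof.
have : closed ((fun x => enorm (x - c)) @^-1` [set t | t <= r]).
  apply: preimage_closed (@closed_le R r) => x _.
  have cB : (fun y => y - c) @ x --> x - c.
    exact: (cvgB (@cvg_id _ (nbhs x)) (@cvg_cst _ c _ (nbhs x) _)).
  exact: (continuous_comp cB (@continuous_enorm (x - c))).
by [].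
Qed.

Lemma compact_ecball c (r : R) : compact (ecball c r).
Proof.
apply: bounded_closed_compact; last exact: closed_ecball.
exists (r + `|c|); split; first exact: num_real.
move=> M rM x /= xr; apply: le_trans (ltW rM).
rewrite -[x](subrK c); apply: le_trans (ler_normD _ _) _; rewrite lerD2r.
rewrite [leLHS]/Num.norm /= mx_normrE; apply/bigmax_leP; split => /=.
  by apply: le_trans xr; apply: enorm_ge0.
by case=> i j _; rewrite ord1; apply: le_trans xr; apply: coord_le_enorm.
Qed.

Lemma compact_sphere (r : R) : compact [set x | enorm x = r].
Proof.
apply: (@subclosed_compact _ _ (ecball 0 r)); first last.
- by move=> x /= <-; rewrite /ecball /= subr0.
- exact: compact_ecball.
have : closed ((@enorm R) @^-1` [set t | t = r]).
  by apply: preimage_closed (@closed_eq R r) => x _; exact: continuous_enorm.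
by [].
Qed.

Lemma enormZ t x : 0 <= t -> enorm (t *: x) = t * enorm x.
Proof.
move=> t0; rewrite /enorm -{2}(ger0_norm t0) -sqrtr_sqr -sqrtrM ?sqr_ge0 //.
by rewrite mulr_sumr; congr Num.sqrt; apply: eq_bigr => i _; rewrite mxE exprMn.
Qed.

Lemma enorm0 : enorm (0 : 'rV[R]_3) = 0.
Proof. by rewrite /enorm big1 ?sqrtr0 // => i _; rewrite mxE expr0n. Qed.

Lemma enorm_eq0 x : enorm x = 0 -> x = 0.
Proof.
move=> x0; apply/rowP => i; apply/eqP.
by rewrite mxE -normr_le0 -x0 coord_le_enorm.
Qed.

(** Taking the same [d] for the three axes is possible because the unit vectors
    also have norm at most 1 for the norm that defines the topology. *)
Lemma ball_enorm_lines x (r : R) : enorm x < r ->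
  exists2 d, 0 < d & forall i t, `|t| < d -> enorm (x + t *: delta_mx 0 i) < r.
Proof.
move=> xr; have /cvgr_lt/(_ _ xr)/nbhs_ballP[d /= d0 xd] := @continuous_enorm x.
exists d => // i t td; apply: xd.
rewrite -ball_normE /= opprD addrA subrr sub0r normrN normrZ.
apply: le_lt_trans td; rewrite ler_piMr // [leLHS]/Num.norm /= mx_normrE.
apply/bigmax_leP; split => //= -[j k] _ /=; rewrite mxE.
by rewrite normr_nat lern1 leq_b1.
Qed.

End Preliminaries.

(** * Powers of null quadratics and Rodrigues' formula *)

Section NullQuadratic.
Variable F : numFieldType.
Implicit Types (a b z : F) (p : {poly F}).

(** Taylor's formula at [z], read as an identity between polynomials. *)
Lemma coef_comp_affine p z b j :
  (p \Po (z%:P + b *: 'X))`_j = b ^+ j * p^`N(j).[z].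
Proof.
rewrite /comp_poly nderiv_taylor; last exact: mulrC.
rewrite size_map_polyC coef_sum.
under eq_bigr => i _ do
  rewrite nderivn_map horner_map exprZn /= coefCM coefZ coefXn mulrC -mulrA.
have [jp|pj] := ltnP j (size p).
  rewrite (bigD1 (Ordinal jp)) //= eqxx mul1r big1 ?addr0 // => i.
  by rewrite -val_eqE /= eq_sym => /negPf ->; rewrite mul0r mulr0.
rewrite nderivn_poly0 // horner0 mulr0 big1 // => i _.
by rewrite gtn_eqF ?mul0r ?mulr0 // (leq_trans (ltn_ord i)).
Qed.

(** For conjugate a and b this is s times the pairing of the point
    (Re b, Im b, z) with the null vector
    ((s - 1/s) / 2, i (s + 1/s) / 2, 1), as a polynomial in s.  Keeping a and b
    independent allows the specialization a = 0, b = 1 below. *)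
Definition null_quad a b z : {poly F} :=
  (- (a / 2))%:P + z *: 'X + (b / 2) *: 'X^2.

(** Completing the square, [2 b] times the null quadratic is [(z + b X)^2 - 1],
    and the powers of the latter are Taylor expansions at [z]. *)
Lemma coef_null_quad_exp_neq0 a b z n k : b != 0 -> z ^+ 2 + a * b = 1 ->
  (null_quad a b z ^+ n)`_(n + k)
  = b ^+ k / 2 ^+ n * (('X ^+ 2 - 1) ^+ n : {poly F})^`N(n + k).[z].
Proof.
move=> b0 e.
have sq : (2 * b) *: null_quad a b z = ('X ^+ 2 - 1) \Po (z%:P + b *: 'X).
  have [h ah] : exists h, a = 2 * h by exists (a / 2); field.
  have [g bg] : exists g, b = 2 * g by exists (b / 2); field.
  rewrite -polyC1 comp_polyB comp_polyC comp_Xn_poly /null_quad.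
  have -> : 1%:P = (z ^+ 2 + a * b)%:P :> {poly F} by rewrite e.
  rewrite ah bg.
  have -> : 2 * h / 2 = h by field.
  have -> : 2 * g / 2 = g by field.
  rewrite -!mul_polyC; ring.
have /(congr1 (fun p : {poly F} => p ^+ n)) := sq.
rewrite exprZn -rmorphXn /= => /(congr1 (fun p : {poly F} => p`_(n + k))).
rewrite coefZ coef_comp_affine => sqn.
have nz : (2 * b) ^+ n != 0 by rewrite expf_neq0 // mulf_neq0 // pnatr_eq0.
apply: (mulfI nz); rewrite sqn exprMn exprD; field.
by rewrite expf_neq0 // pnatr_eq0.
Qed.

Lemma coef_null_quad_exp_eq0 a z n k :
  (null_quad a 0 z ^+ n)`_(n + k) = z ^+ n *+ (k == 0).
Proof.
rewrite /null_quad mul0r scale0r addr0 -comp_Xn_poly coef_comp_affine.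
rewrite nderivnXn; case: k => [|k].
  by rewrite addn0 subnn binn expr0 mulr1n hornerC mulr1.
by rewrite bin_small ?mulr0n ?horner0 ?mulr0 // addnS ltnS leq_addr.
Qed.

(** On the polar axis [b] vanishes and the square cannot be completed.  For
    [k = 0] the left-hand side is then [z ^+ n], and both sides are those of
    the case [a = 0], [b = 1], where the square can be completed. *)
Lemma coef_null_quad_exp a b z n k : z ^+ 2 + a * b = 1 ->
  (null_quad a b z ^+ n)`_(n + k)
  = b ^+ k / 2 ^+ n * (('X ^+ 2 - 1) ^+ n : {poly F})^`N(n + k).[z].
Proof.
have [-> e|b0] := eqVneq b 0; last exact: coef_null_quad_exp_neq0.
rewrite coef_null_quad_exp_eq0; case: k => [|k]; last by rewrite expr0n !mul0r.
have {}e : z ^+ 2 + 0 * 1 = 1 by rewrite -e mulr0 mul0r.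
have := @coef_null_quad_exp_neq0 0 1 z n 0 (oner_neq0 F) e.
rewrite !expr0 => <-.
have -> : null_quad 0 1 z = 'X * (z%:P + 2^-1 *: 'X).
  rewrite /null_quad mul0r oppr0 add0r mulrDr -mul_polyC mulrC div1r.
  by rewrite -!scalerAr.
rewrite exprMn mulrC addn0 coefMXn ltnn subnn -horner_coef0 horner_exp.
by rewrite !hornerE.
Qed.

Lemma null_quad_affine a1 b1 z1 a2 b2 z2 t :
  null_quad (a1 + t * a2) (b1 + t * b2) (z1 + t * z2)
  = null_quad a1 b1 z1 + t *: null_quad a2 b2 z2.
Proof.
apply/polyP => i; rewrite !(coefD, coefZ, coefC, coefX, coefXn).
by case: (i == 0); case: (i == 1); case: (i == 2); field.
Qed.

(** The values of the linear map at the three coordinate vectors, [w] being the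
    imaginary unit or its opposite; this identity is what makes its powers
    harmonic. *)
Lemma null_quad_axes w : w ^+ 2 = -1 ->
  null_quad 1 1 0 ^+ 2 + null_quad (- w) w 0 ^+ 2 + null_quad 0 0 1 ^+ 2 = 0.
Proof.
move=> w2; have [h hE] : exists h : F, h = 2^-1 by exists 2^-1.
have h2 : 2 * h = 1 by rewrite hE divff // pnatr_eq0.
rewrite /null_quad -hE !mul0r !scale0r !scale1r -!mul_polyC oppr0 mul1r.
rewrite mulNr opprK.
have -> : (- h)%:P = - h%:P :> {poly F} by rewrite polyCN.
have w2P : w%:P ^+ 2 = -1 :> {poly F} by rewrite -rmorphXn /= w2 rmorphN1.
have h2P : 2 * h%:P = 1 :> {poly F}.
  by rewrite mulr_natl -polyCMn -mulr_natl h2.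
rewrite polyCM.
transitivity ('X ^+ 2 * (1 - (2 * h%:P) ^+ 2)
  + (w%:P ^+ 2 + 1) * (h%:P * (1 + 'X ^+ 2)) ^+ 2 : {poly F}); first by ring.
by rewrite w2P h2P; ring.
Qed.
End NullQuadratic.

(** * The maximum principle along the axes *)

Section MaximumPrinciple.
Variable R : realType.
Implicit Types (x : 'rV[R]_3) (u v : 'rV[R]_3 -> R[i]).

(** Adding the inequalities at [t] and [- t] cancels the linear term, so the
    sign of the quadratic coefficient decides for small [t]. *)
Lemma coef2_le0_at_max (p : {poly R}) d : 0 < d ->
  (forall t, `|t| < d -> p.[t] <= p.[0]) -> p`_2 <= 0.
Proof.
move=> d0 pmax; rewrite leNgt; apply/negP => p2.
pose q := drop_poly 2 p.
have pE t : p.[t] = p`_0 + p`_1 * t + q.[t] * t ^+ 2.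
  rewrite -{1}[p](poly_take_drop 2) !hornerE /take_poly horner_poly.
  by rewrite !big_ord_recl big_ord0 /= expr0 mulr1 addr0 expr1.
have q0 : 0 < q.[0] by rewrite horner_coef0 coef_drop_poly.
have /(_ 0)/cvgr_gt/(_ 0 q0) := @continuous_horner R q.
move=> /nbhs_ballP[e /= e0 qe].
pose t := Num.min d e / 2.
have m0 : 0 < Num.min d e by rewrite lt_min d0.
have t0 : 0 < t by rewrite divr_gt0.
have tm : t < Num.min d e by rewrite ltr_pdivrMr // ltr_pMr // ltr1n.
have {tm} [td te] : t < d /\ t < e by move: tm; rewrite lt_min => /andP[].
have qt : 0 < q.[t] by apply: qe; rewrite /ball /= sub0r normrN gtr0_norm.
have qNt : 0 < q.[- t] by apply: qe; rewrite /ball /= sub0r opprK gtr0_norm.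
have := pmax t; rewrite gtr0_norm // => /(_ td).
have := pmax (- t); rewrite normrN gtr0_norm // => /(_ td).
rewrite !pE sqrrN expr0n !mulr0 !addr0.
have := mulr_gt0 qt (exprn_gt0 2 t0); have := mulr_gt0 qNt (exprn_gt0 2 t0).
lra.
Qed.

Definition Re_poly (p : {poly R[i]}) := \poly_(i < size p) complex.Re p`_i.
Definition Im_poly (p : {poly R[i]}) := \poly_(i < size p) complex.Im p`_i.

Lemma horner_Re_poly (p : {poly R[i]}) t :
  (Re_poly p).[t] = complex.Re p.[t%:C%C].
Proof.
rewrite horner_poly horner_coef Re_sum; apply: eq_bigr => i _.
by rewrite -rmorphXn Re_mul_real.
Qed.

Lemma horner_Im_poly (p : {poly R[i]}) t :
  (Im_poly p).[t] = complex.Im p.[t%:C%C].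
Proof.
rewrite horner_poly horner_coef Im_sum; apply: eq_bigr => i _.
by rewrite -rmorphXn Im_mul_real.
Qed.

Lemma coef_Re_poly (p : {poly R[i]}) i : (Re_poly p)`_i = complex.Re p`_i.
Proof. by rewrite coef_poly; case: ltnP => // /(nth_default 0) ->. Qed.

Lemma coef_Im_poly (p : {poly R[i]}) i : (Im_poly p)`_i = complex.Im p`_i.
Proof. by rewrite coef_poly; case: ltnP => // /(nth_default 0) ->. Qed.

Definition continuous_ReIm u :=
  continuous (fun x => complex.Re (u x)) /\
  continuous (fun x => complex.Im (u x)).

Lemma continuous_ReIm_cst (a : R[i]) : continuous_ReIm (fun=> a).
Proof. by split; exact: cst_continuous. Qed.

Lemma continuous_ReIm_real (g : 'rV[R]_3 -> R) : continuous g ->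
  continuous_ReIm (fun x => (g x)%:C%C).
Proof. by move=> cg; split=> //; exact: cst_continuous. Qed.

Lemma continuous_ReImD (u v : 'rV[R]_3 -> R[i]) :
  continuous_ReIm u -> continuous_ReIm v -> continuous_ReIm (fun x => u x + v x).
Proof.
move=> [u1 u2] [v1 v2]; split.
  have -> : (fun x => complex.Re (u x + v x))
    = (fun x => complex.Re (u x) + complex.Re (v x)).
    by apply/funext => x; case: (u x) (v x) => [a b] [c d].
  by move=> x; exact: (cvgD (u1 x) (v1 x)).
have -> : (fun x => complex.Im (u x + v x))
  = (fun x => complex.Im (u x) + complex.Im (v x)).
  by apply/funext => x; case: (u x) (v x) => [a b] [c d].
by move=> x; exact: (cvgD (u2 x) (v2 x)).
Qed.

Lemma continuous_ReImM (u v : 'rV[R]_3 -> R[i]) :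
  continuous_ReIm u -> continuous_ReIm v -> continuous_ReIm (fun x => u x * v x).
Proof.
move=> [u1 u2] [v1 v2]; split.
  have -> : (fun x => complex.Re (u x * v x)) = (fun x =>
      complex.Re (u x) * complex.Re (v x) - complex.Im (u x) * complex.Im (v x)).
    by apply/funext => x; case: (u x) (v x) => [a b] [c d].
  by move=> x; exact: (cvgB (cvgM (u1 x) (v1 x)) (cvgM (u2 x) (v2 x))).
have -> : (fun x => complex.Im (u x * v x)) = (fun x =>
    complex.Re (u x) * complex.Im (v x) + complex.Im (u x) * complex.Re (v x)).
  by apply/funext => x; case: (u x) (v x) => [a b] [c d].
by move=> x; exact: (cvgD (cvgM (u1 x) (v2 x)) (cvgM (u2 x) (v1 x))).
Qed.

Lemma continuous_ReIm_sum I (r : seq I) (u : I -> 'rV[R]_3 -> R[i]) :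
  (forall i, continuous_ReIm (u i)) -> continuous_ReIm (fun x => \sum_(i <- r) u i x).
Proof.
move=> cu; elim: r => [|i r IH].
  have -> : (fun x => \sum_(i <- [::]) u i x) = (fun=> 0).
    by apply/funext => x; rewrite big_nil.
  exact: continuous_ReIm_cst.
have -> : (fun x => \sum_(j <- i :: r) u j x)
  = (fun x => u i x + \sum_(j <- r) u j x).
  by apply/funext => x; rewrite big_cons.
exact: continuous_ReImD.
Qed.

(** The Laplace equation for a function that is polynomial on the lines parallel
    to the axes: the second derivative along an axis is twice the coefficient
    of degree 2.  This form is stable under linear combinations and needs no
    differential calculus. *)
Definition axes_harmonic u := continuous_ReIm u /\ forall x,
  exists2 P : 'I_3 -> {poly R[i]},
    forall i t, u (x + t *: delta_mx 0 i) = (P i).[t%:C%C]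
    & \sum_i (P i)`_2 = 0.

Lemma axes_harmonicZ (K : R[i]) u :
  axes_harmonic u -> axes_harmonic (fun x => K * u x).
Proof.
move=> [cu hu]; split; first exact: continuous_ReImM (continuous_ReIm_cst K) cu.
move=> x; have [P uP P2] := hu x; exists (fun i => K *: P i) => [i t|].
  by rewrite uP hornerZ.
by under eq_bigr => i _ do rewrite coefZ; rewrite -mulr_sumr P2 mulr0.
Qed.

Lemma axes_harmonicD u v : axes_harmonic u -> axes_harmonic v ->
  axes_harmonic (fun x => u x + v x).
Proof.
move=> [cu hu] [cv hv]; split; first exact: continuous_ReImD.
move=> x; have [P uP P2] := hu x; have [Q vQ Q2] := hv x.
exists (fun i => P i + Q i) => [i t|]; first by rewrite uP vQ hornerD.
by under eq_bigr => i _ do rewrite coefD; rewrite big_split /= P2 Q2 addr0.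
Qed.

Lemma axes_harmonic_sum I (r : seq I) (u : I -> 'rV[R]_3 -> R[i]) :
  (forall i, axes_harmonic (u i)) ->
  axes_harmonic (fun x => \sum_(i <- r) u i x).
Proof.
move=> hu; elim: r => [|i r IH]; last first.
  under [X in axes_harmonic X]funext => x do rewrite big_cons.
  exact: axes_harmonicD.
under [X in axes_harmonic X]funext => x do rewrite big_nil.
split; first exact: continuous_ReIm_cst.
move=> x; exists (fun=> 0) => [i t|]; rewrite ?horner0 // big1 // => i _.
by rewrite coef0.
Qed.

(** The perturbation by [e |x|^2] makes the sum of the second order coefficients
    of [|u|^2] positive: the coefficient of degree 2 of [|P|^2] for
    [P = P_0 + P_1 t + P_2 t^2 + ...] is [|P_1|^2 + 2 Re (conj P_0 P_2)], and
    the last terms add up to 0 over the axes, [P_0] being the common value of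
    [u] at the point. *)
Lemma maximum_principle u (r M : R) : 0 < r -> axes_harmonic u ->
    (forall x, enorm x = r -> Normc.normc (u x) <= M) ->
  forall x, enorm x <= r -> Normc.normc (u x) <= M.
Proof.
move=> r0 [[cRe cIm] uh] uM x xr.
have ball0 y : ecball 0 r y = (enorm y <= r) by rewrite /ecball /= subr0.
have M0 : 0 <= M.
  have : enorm (r *: delta_mx 0 0 : 'rV[R]_3) = r.
    rewrite /enorm (bigD1 ord0) //= big1 ?addr0 => [|i i0]; last first.
      by rewrite !mxE /= (negPf i0) mulr0 expr0n.
    by rewrite !mxE /= mulr1 sqrtr_sqr gtr0_norm.
  by move/uM; apply: le_trans; apply: normc_ge0.
rewrite -(@ler_pXn2r _ 2) ?nnegrE ?normc_ge0 //.
(* On the sphere of radius r the perturbation e |x|^2 is then equal to e'. *)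
apply/ler_addgt0Pr => e' e'0; pose e : R := e' / r ^+ 2.
have e0 : 0 < e by rewrite divr_gt0 // exprn_gt0.
pose w y : R := Normc.normc (u y) ^+ 2 + e * enorm y ^+ 2.
have cw : continuous w.
  have -> : w = (fun y => complex.Re (u y) * complex.Re (u y)
     + complex.Im (u y) * complex.Im (u y) + e * (enorm y * enorm y)).
    by apply/funext => y; rewrite /w normc2 !expr2.
  move=> y; have ce := @continuous_enorm R y.
  exact: (cvgD (cvgD (cvgM (cRe y) (cRe y)) (cvgM (cIm y) (cIm y)))
    (cvgMl_tmp (cvgM ce ce))).
have [||y yB ymax] := @EVT_max_rV R 3 w _ _ (@compact_ecball R 0 r).
- by exists x; rewrite ball0.
- exact: continuous_subspaceT.
have {}ymax z : enorm z <= r -> w z <= w y.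
  by move=> zr; apply: ymax; rewrite inE ball0.
move: yB; rewrite inE ball0 le_eqVlt => /predU1P[yr|yr].
  apply: (@le_trans _ _ (w x)); first by rewrite lerDl mulr_ge0 ?sqr_ge0 // ltW.
  apply: le_trans (ymax _ xr) _; rewrite /w yr /e divfK ?gt_eqF ?exprn_gt0 //.
  by rewrite lerD2r ler_pXn2r ?nnegrE ?normc_ge0 ?uM.
have [d d0 dr] := ball_enorm_lines yr.
have [P uP P2] := uh y.
pose Q i := Re_poly (P i) ^+ 2 + Im_poly (P i) ^+ 2
  + e *: ((enorm y ^+ 2)%:P + (2 * y 0 i) *: 'X + 'X^2).
have wQ i t : w (y + t *: delta_mx 0 i) = (Q i).[t].
  have -> : (Q i).[t] = complex.Re (P i).[t%:C%C] ^+ 2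
      + complex.Im (P i).[t%:C%C] ^+ 2
      + e * (enorm y ^+ 2 + 2 * y 0 i * t + t ^+ 2).
    by rewrite !hornerE horner_Re_poly horner_Im_poly.
  rewrite /w normc2 uP; congr (_ + e * _).
  rewrite !enorm2 (bigD1 i) //= [in RHS](bigD1 i) //= !mxE !eqxx mulr1.
  rewrite (eq_bigr (fun j => y 0 j ^+ 2)); last first.
    by move=> j ji; rewrite !mxE (negPf ji) andbF mulr0 addr0.
  ring.
have Q2 i : (Q i)`_2 <= 0.
  apply: (coef2_le0_at_max d0) => t td; rewrite -!wQ scale0r addr0.
  by apply: ymax; apply/ltW/dr.
have coefsq (p : {poly R}) : (p ^+ 2)`_2 = 2 * (p`_0 * p`_2) + p`_1 ^+ 2.
  rewrite expr2 coefM !big_ord_recl big_ord0 /= /bump /=; ring.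
have {}Q2 i : 2 * (complex.Re (u y) * complex.Re (P i)`_2)
    + 2 * (complex.Im (u y) * complex.Im (P i)`_2) < 0.
  apply: lt_le_trans (Q2 i).
  rewrite /Q !(coefD, coefZ, coefC, coefX, coefXn) /= !coefsq.
  rewrite !coef_Re_poly !coef_Im_poly.
  have := uP i 0; rewrite scale0r addr0 horner_coef0 => <-.
  have := sqr_ge0 (complex.Re (P i)`_1); have := sqr_ge0 (complex.Im (P i)`_1).
  rewrite mulr0 !add0r mulr1; lra.
have := congr1 (@complex.Re R) P2; have := congr1 (@complex.Im R) P2.
rewrite Re_sum Im_sum /= => I0 R0.
have : \sum_i (2 * (complex.Re (u y) * complex.Re (P i)`_2)
    + 2 * (complex.Im (u y) * complex.Im (P i)`_2)) < 0.
  rewrite !big_ord_recl big_ord0.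
  have := Q2 ord0; have := Q2 (lift ord0 ord0).
  have := Q2 (lift ord0 (lift ord0 ord0)); lra.
by rewrite big_split /= -!mulr_sumr I0 R0 !mulr0 addr0 ltxx.
Qed.
End MaximumPrinciple.

(** * Solid harmonics are coefficients of powers of null quadratics *)

Section SolidHarmonics.
Variable R : realType.
Implicit Types (x : 'rV[R]_3) (s t z : R) (n k : nat) (m : int).

Lemma continuous_ReIm_coef_exp (A : 'rV[R]_3 -> {poly R[i]}) :
  (forall j, continuous_ReIm (fun x => (A x)`_j)) ->
  forall n j, continuous_ReIm (fun x => (A x ^+ n)`_j).
Proof.
move=> cA; elim=> [|n IH] j.
  exact: (continuous_ReIm_cst (1 : {poly R[i]})`_j).
have -> : (fun x => (A x ^+ n.+1)`_j)
  = (fun x => \sum_(i < j.+1) (A x)`_i * (A x ^+ n)`_(j - i)).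
  by apply/funext => x; rewrite exprS coefM.
by apply: continuous_ReIm_sum => i; apply: continuous_ReImM.
Qed.

(** The sign [s] exchanges the two conjugate variables; [s = 1] serves the
    nonnegative orders and [s = -1] the negative ones. *)
Definition solid_quad s x : {poly R[i]} :=
  null_quad (x 0 0 +i* (- (s * x 0 1)))%C (x 0 0 +i* (s * x 0 1))%C
    (x 0 2)%:C%C.

Lemma continuous_ReIm_solid_quad s j : continuous_ReIm (fun x => (solid_quad s x)`_j).
Proof.
have cc i : continuous_ReIm (fun x => (x 0 i)%:C%C).
  by apply: continuous_ReIm_real => x; exact: coord_continuous.
have -> : (fun x => (solid_quad s x)`_j) = (fun x =>
    (x 0 0)%:C%C * (null_quad 1 1 0)`_j
  + (x 0 1)%:C%C * (null_quad (0 +i* (- s)) (0 +i* s) 0)%C`_j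
  + (x 0 2)%:C%C * (null_quad 0 0 1)`_j).
  apply/funext => x; rewrite -!coefZ -!coefD; congr (_`_j).
  rewrite -[(x 0 0)%:C%C *: _]add0r.
  have {1}-> : 0 = null_quad 0 0 0 :> {poly R[i]}.
    by rewrite /null_quad !mul0r !scale0r !addr0 oppr0.
  rewrite -!null_quad_affine /solid_quad; congr null_quad; apply/eqP;
    rewrite eq_complex /=; apply/andP; split; apply/eqP; ring.
by do !apply: continuous_ReImD; apply: continuous_ReImM => //; exact: continuous_ReIm_cst.
Qed.

Lemma solid_quad_affine s x t y :
  solid_quad s (x + t *: y) = solid_quad s x + t%:C%C *: solid_quad s y.
Proof.
rewrite -null_quad_affine /solid_quad; congr null_quad; apply/eqP;
  rewrite eq_complex /= !mxE; apply/andP; split; apply/eqP; ring.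
Qed.

Lemma solid_quadZ s t x : solid_quad s (t *: x) = t%:C%C *: solid_quad s x.
Proof.
rewrite -[t *: x]add0r solid_quad_affine.
rewrite /solid_quad !mxE mulr0 oppr0 /null_quad mul0r !scale0r oppr0.
by rewrite !addr0 add0r.
Qed.

(** By linearity the restriction to an axis is [(A + t a_i)^n], whose term in
    [t^2] is ['C(n, 2) A^(n - 2) a_i^2]; the sum of the [a_i^2] vanishes. *)
Lemma axes_harmonic_coef_exp s n j : s ^+ 2 = 1 ->
  axes_harmonic (fun x => (solid_quad s x ^+ n)`_j).
Proof.
move=> s2; split; first exact/continuous_ReIm_coef_exp/continuous_ReIm_solid_quad.
move=> x; pose e i : 'rV[R]_3 := delta_mx 0 i.
exists (fun i => \poly_(l < n.+1)
    (solid_quad s x ^+ (n - l) * solid_quad s (e i) ^+ l *+ 'C(n, l))`_j)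
  => [i t|].
  rewrite horner_poly solid_quad_affine exprDn coef_sum; apply: eq_bigr => l _.
  by rewrite exprZn -scalerAr scalerMnr coefZ mulrC.
have [n2|/negPf n2] := boolP (2 < n.+1)%N; last first.
  by rewrite big1 // => i _; rewrite coef_poly n2.
under eq_bigr => i _ do rewrite coef_poly n2.
rewrite -coef_sum sumrMnl -mulr_sumr.
suff -> : \sum_i solid_quad s (e i) ^+ 2 = 0 by rewrite mulr0 mul0rn coef0.
have w2 : (0 +i* s)%C ^+ 2 = -1 :> R[i].
  apply/eqP; rewrite eq_complex /= !mul0r mulr0 sub0r addr0 -expr2 s2.
  by rewrite oppr0 !eqxx.
have eE i l : e i 0 l = (l == i)%:R by rewrite mxE eqxx.
pose q i := solid_quad s (e i); rewrite -[\sum_i _]/(\sum_i q i ^+ 2).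
have q0 : q ord0 = null_quad 1 1 0.
  by rewrite /q /solid_quad !eE mulr0 oppr0.
have q1 : q (lift ord0 ord0) = null_quad (- (0 +i* s)%C) (0 +i* s)%C 0.
  rewrite /q /solid_quad !eE mulr1; congr null_quad.
  by apply/eqP; rewrite eq_complex /= oppr0 !eqxx.
have q2 : q (lift ord0 (lift ord0 ord0)) = null_quad 0 0 1.
  rewrite /q /solid_quad !eE.
  have -> : (0 == lift ord0 (lift ord0 ord0) :> 'I_3) = false by [].
  have -> : (1 == lift ord0 (lift ord0 ord0) :> 'I_3) = false by [].
  have -> : (2 == lift ord0 (lift ord0 ord0) :> 'I_3) = true by [].
  by rewrite mulr0 oppr0; congr null_quad.
move: q q0 q1 q2 => q q0 q1 q2.
rewrite !big_ord_recl big_ord0 q0 q1 q2 [X in _ + (_ + X)]addr0 addrA.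
exact: null_quad_axes w2.
Qed.

Definition solid_poly n m x : R[i] :=
  (solid_quad (if m is Posz _ then 1 else -1) x ^+ n)`_(n + absz m).

Lemma axes_harmonic_solid_poly n m : axes_harmonic (solid_poly n m).
Proof.
by apply: axes_harmonic_coef_exp; case: m => _; rewrite ?sqrrN expr1n.
Qed.

Lemma solid_polyZ n m t x :
  solid_poly n m (t *: x) = (t ^+ n)%:C%C * solid_poly n m x.
Proof. by rewrite /solid_poly solid_quadZ exprZn coefZ rmorphXn. Qed.

(** The derivative of order n + k of (t^2 - 1)^n is, up to the normalization
    in Rodrigues' formula, the derivative of order k of P_n. *)
Lemma coef_null_quad_legendre (a b : R[i]) z n k : z%:C%C ^+ 2 + a * b = 1 ->
  (null_quad a b z%:C%C ^+ n)`_(n + k)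
  = (n`!%:R / (n + k)`!%:R * ((legendre R n)^`(k)).[z])%:C%C * b ^+ k.
Proof.
move=> e; rewrite coef_null_quad_exp //.
have -> : ('X ^+ 2 - 1) ^+ n = map_poly (real_complex R) (('X ^+ 2 - 1) ^+ n).
  by rewrite rmorphXn rmorphB rmorphXn /= map_polyX rmorph1.
rewrite nderivn_map horner_map /legendre derivnZ hornerZ.
have -> (p : {poly R}) : p^`(n)^`(k) = p^`(n + k).
  by rewrite /derivn -iterD addnC.
rewrite nderivn_def hornerMn.
rewrite [RHS]mulrC -[LHS]mulrA; congr (_ * _).
rewrite -[2]/(2%:R) -(rmorph_nat (real_complex R)) -rmorphXn -fmorphV -rmorphM.
congr (_%:C)%C; rewrite -mulr_natr.
by field; rewrite ?expf_neq0 ?pnatr_eq0 ?gtn_eqF ?fact_gt0.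
Qed.

Lemma de_moivre (phi : R) k :
  (cos (k%:R * phi) +i* sin (k%:R * phi))%C = ((cos phi +i* sin phi) ^+ k)%C.
Proof.
elim: k => [|k IH]; first by rewrite mul0r cos0 sin0.
rewrite exprS -IH -natr1 mulrDl mul1r cosD sinD; apply/eqP.
by rewrite eq_complex /=; apply/andP; split; apply/eqP; ring.
Qed.

(** With [b = sin theta e^(i phi)], the factor [b ^ k] supplies both the power
    of [sin theta] in the associated Legendre function and the exponential in
    the azimuth. *)
Lemma harmonic_angles_solid n m : exists K : R[i], forall theta phi,
  0 <= sin theta ->
  harmonic_angles n m theta phi = K * solid_poly n m (spherical theta phi).
Proof.
pose N (l : int) : R := Num.sqrt ((2 * n + 1)%:R / (4 * pi)
  * ((absz (n%:Z - l))`!%:R / (absz (n%:Z + l))`!%:R)).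
have nn j : j`!%:R != 0 :> R by rewrite pnatr_eq0 gtn_eqF ?fact_gt0.
have sinE theta : 0 <= sin theta ->
    Num.sqrt (1 - cos theta ^+ 2) = sin theta :> R.
  by move=> s0; rewrite -sin2cos2 sqrtr_sqr ger0_norm.
have key s theta phi k : s ^+ 2 = 1 ->
  (solid_quad s (spherical theta phi) ^+ n)`_(n + k)
  = (n`!%:R / (n + k)`!%:R * ((legendre R n)^`(k)).[cos theta]
     * sin theta ^+ k)%:C%C * (cos phi +i* (s * sin phi))%C ^+ k.
  move=> s2; rewrite /solid_quad !mxE /= coef_null_quad_legendre; last first.
    apply/eqP; rewrite eq_complex /=; apply/andP; split; apply/eqP; last by ring.
    transitivity (cos theta ^+ 2
      + sin theta ^+ 2 * (cos phi ^+ 2 + s ^+ 2 * sin phi ^+ 2)); first by ring.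
    by rewrite s2 mul1r cos2Dsin2 mulr1 cos2Dsin2.
  have -> : (sin theta * cos phi +i* (s * (sin theta * sin phi)))%C
    = (sin theta)%:C%C * (cos phi +i* (s * sin phi))%C.
    by apply/eqP; rewrite eq_complex /=; apply/andP; split; apply/eqP; ring.
  by rewrite exprMn mulrA -rmorphXn -rmorphM.
case: m => k.
  exists (N k%:Z * (-1) ^+ k * (n + k)`!%:R / n`!%:R)%:C%C => theta phi s0.
  rewrite /harmonic_angles /solid_poly key ?expr1n // mul1r -/(N k%:Z).
  rewrite /= /assoc_legendre_nneg sinE // [RHS]mulrA [LHS]mulrAC.
  rewrite -!(rmorphM (real_complex R)) /= de_moivre; congr (_%:C%C * _).
  by field; rewrite !nn.
exists (N (Negz k) * (-1) ^+ k.+1 * (-1) ^+ k.+1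
  * ((n - k.+1)`!%:R / (n + k.+1)`!%:R) * (n + k.+1)`!%:R / n`!%:R)%:C%C => theta phi s0.
rewrite /harmonic_angles /solid_poly key ?sqrrN ?expr1n // -/(N (Negz k)).
rewrite /= /assoc_legendre_nneg sinE // [RHS]mulrA [LHS]mulrAC.
rewrite -!(rmorphM (real_complex R)) /=.
rewrite NegzE mulrNz mulNr cosN sinN mulN1r.
have -> : (cos (k.+1%:~R * phi) +i* - sin (k.+1%:~R * phi))%C
  = ((cos phi +i* - sin phi) ^+ k.+1)%C.
  by rewrite -sinN -cosN -mulrN -[in RHS]sinN -[in RHS]cosN -de_moivre.
by congr (_%:C%C * _); field; rewrite !nn.
Qed.

Lemma sph_harmonic_solid n m : exists K : R[i], forall xi, sphere2 xi ->
  sph_harmonic n m xi = K * solid_poly n m xi.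
Proof.
have [K hK] := harmonic_angles_solid n m; exists K => xi xi1.
rewrite /sph_harmonic hK ?sphericalK //.
have xr : -1 <= xi 0 2 <= 1 by rewrite -ler_norml -xi1 coord_le_enorm.
by rewrite sin_ge0_pi // acos_ge0 // acos_lepi.
Qed.

(** This makes the solid harmonic of degree 0 constant up to the origin, where
    the normalization of the argument degenerates. *)
Lemma sph_harmonic00 xi eta :
  sph_harmonic 0 0 xi = sph_harmonic 0 0 eta :> R[i].
Proof.
rewrite /sph_harmonic /harmonic_angles /= !mul0r; congr (_ * _%:C%C).
by rewrite /assoc_legendre_nneg /legendre /= expr0 -polyC1 !hornerE.
Qed.

Lemma sphere2_normalize x : x != 0 -> sphere2 ((enorm x)^-1 *: x).
Proof.
move=> x0; rewrite /sphere2 /= enormZ ?invr_ge0 ?enorm_ge0 // mulVf //.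
by apply: contra_neq x0; exact: enorm_eq0.
Qed.

Lemma solid_harmonic_solid n m : (absz m <= n)%N -> exists K : R[i], forall x,
  solid_harmonic n m x = K * solid_poly n m x.
Proof.
move=> mn; have [K hK] := sph_harmonic_solid n m; exists K => x.
have [->|x0] := eqVneq x 0; last first.
  rewrite /solid_harmonic hK; last exact: sphere2_normalize.
  rewrite mulrCA -solid_polyZ scalerA divff ?scale1r //.
  by apply: contra_neq x0; exact: enorm_eq0.
rewrite /solid_harmonic enorm0 scaler0; case: n mn hK => [|n] mn hK.
  move: mn hK; rewrite leqn0 absz_eq0 => /eqP -> hK.
  rewrite expr0 mul1r (sph_harmonic00 _ (delta_mx 0 0)) hK //.
  by rewrite /sphere2 /= /enorm (bigD1 ord0) //= big1 ?addr0 => [|i i0];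
    rewrite !mxE /= ?(negPf i0) ?expr0n // expr1n sqrtr1.
have -> : (0 : 'rV[R]_3) = 0 *: (0 : 'rV[R]_3) by rewrite scaler0.
by rewrite solid_polyZ expr0n !mul0r mulr0.
Qed.
End SolidHarmonics.

(** * Integrals of functions of unknown measurability *)

Section UnmeasuredIntegral.
Context d (T : measurableType d) (R : realType).
Variables (mu : {measure set T -> \bar R}) (D : set T).
Import HBNNSimple.

(** The integral of a nonnegative function is a supremum over the simple
    functions below it, which makes it monotone and homogeneous for arbitrary
    functions; additivity is the property that requires measurability. *)
Lemma ge0_le_integral_nomeas (f g : T -> \bar R) :
  (forall x, D x -> 0 <= f x)%E -> (forall x, D x -> f x <= g x)%E ->
  (\int[mu]_(x in D) f x <= \int[mu]_(x in D) g x)%E.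
Proof.
move=> f0 fg; have g0 x : D x -> (0 <= g x)%E.
  by move=> Dx; apply: le_trans (fg x Dx); exact: f0.
rewrite !ge0_integralE //; apply: ereal_sup_le => _ [h hf <-]; exists h => // x.
apply: le_trans (hf x) _; rewrite /patch; case: ifPn => // /[!inE]; exact: fg.
Qed.

Lemma ge0_integralZl_nomeas_le (f : T -> \bar R) (k : R) : 0 < k ->
  (forall x, D x -> 0 <= f x)%E ->
  (\int[mu]_(x in D) (k%:E * f x) <= k%:E * \int[mu]_(x in D) f x)%E.
Proof.
move=> k0 f0; have kf0 x : D x -> (0 <= k%:E * f x)%E.
  by move=> Dx; apply: mule_ge0; [rewrite lee_fin ltW|exact: f0].
rewrite !ge0_integralE //; apply: ge_ereal_sup => _ [h hf <-].
have k1 : 0 <= k^-1 by rewrite invr_ge0 ltW.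
rewrite -lee_pdivrMl // -sintegralrM; apply: ereal_sup_ubound.
exists (scale_nnsfun h k1) => // x.
rewrite /= EFinM lee_pdivrMl //; apply: le_trans (hf x) _.
by rewrite /patch; case: ifP => //; rewrite mule0.
Qed.

Lemma ge0_integralZl_nomeas (f : T -> \bar R) (k : R) : 0 < k ->
  (forall x, D x -> 0 <= f x)%E ->
  (\int[mu]_(x in D) (k%:E * f x) = k%:E * \int[mu]_(x in D) f x)%E.
Proof.
move=> k0 f0; apply/eqP; rewrite eq_le ge0_integralZl_nomeas_le //=.
rewrite -lee_pdivlMl //; have kV0 : 0 < k^-1 by rewrite invr_gt0.
rewrite [X in (X <= _)%E](_ : _ =
    \int[mu]_(x in D) (k^-1%:E * (k%:E * f x)))%E.
  apply: ge0_integralZl_nomeas_le => // x Dx.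
  by apply: mule_ge0; [rewrite lee_fin ltW|exact: f0].
by apply: eq_integral => x _; rewrite muleA -EFinM mulVf ?gt_eqF // mul1e.
Qed.

Lemma RintegralZl_nomeas (f : T -> R) (k : R) : 0 < k ->
  Rintegral mu D (fun x => k * f x) = k * Rintegral mu D f.
Proof.
move=> k0; rewrite /Rintegral.
have -> : (\int[mu]_(x in D) (k * f x)%:E
  = k%:E * \int[mu]_(x in D) (f x)%:E)%E.
  rewrite integralE [in RHS]integralE.
  have -> : (fun x => (k * f x)%:E) = (fun x => k%:E * (f x)%:E)%E.
    by apply/funext => x; rewrite EFinM.
  rewrite ge0_funeposM ?ge0_funenegM ?ltW //.
  rewrite !ge0_integralZl_nomeas //.
  (* Also when both parts are infinite: +oo - +oo is -oo by convention, and
     this value is preserved by a positive factor. *)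
  move: (integral _ _ _) (integral _ _ _) => [a| |] [b| |] //=;
    rewrite ?gt0_muley ?gt0_muleNy ?lte_fin //=.
  by transitivity (k * b - k * a)%:E => //; rewrite -mulrBr.
case: (integral _ _ _) => [a| |] //=;
  by rewrite ?gt0_muley ?gt0_muleNy ?lte_fin //= mulr0.
Qed.

(** The positive and negative parts both integrate to a number between 0 and
    [K * mu D], so the difference is bounded by [K * mu D] too. *)
Lemma normr_Rintegral_le (f : T -> R) (K : R) : d.-measurable D ->
    (mu D < +oo)%E -> (forall x, D x -> `|f x| <= K) ->
  `|Rintegral mu D f| <= K * fine (mu D).
Proof.
move=> mD Dfin fK; rewrite /Rintegral integralE.
have bound (g : T -> \bar R) : (forall x, D x -> 0 <= g x <= K%:E)%E ->
    exists2 r : R, (\int[mu]_(x in D) g x)%E = r%:E & 0 <= r <= K * fine (mu D).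
  move=> gK; have ge := integral_ge0 mu (fun x Dx => proj1 (andP (gK x Dx))).
  have le : (\int[mu]_(x in D) g x <= (K * fine (mu D))%:E)%E.
    rewrite EFinM fineK ?ge0_fin_numE // -integral_cst //.
    by apply: ge0_le_integral_nomeas => x /gK /andP[].
  move: ge le; case: (integral _ _ _) => [r| |] // r0 rK.
  by exists r => //; rewrite -!lee_fin r0.
have fK2 x : D x -> [/\ f x <= K, - f x <= K & 0 <= K].
  move=> /fK fxK; have := le_trans (normr_ge0 _) fxK.
  by move: fxK; rewrite ler_norml => /andP[? ?] ?; split=> //; lra.
have [|a -> /andP[a0 aK]] := bound ((EFin \o f)^\+)%E.
  move=> x /fK2[? ? ?]; rewrite funepos_ge0 /= funeposE /= -EFin_max lee_fin.
  by rewrite ge_max; apply/andP.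
have [|b -> /andP[b0 bK]] := bound ((EFin \o f)^\-)%E.
  move=> x /fK2[? ? ?]; rewrite funeneg_ge0 /= funenegE /= -EFin_max lee_fin.
  by rewrite ge_max; apply/andP.
by rewrite /= ler_norml; lra.
Qed.
End UnmeasuredIntegral.

(** * Fourier-Laplace projection and Lebesgue constant *)

Section SphereOperators.
Variable R : realType.
Implicit Types (g : 'rV[R]_3 -> R[i]) (n p : nat) (m : int).

Lemma sphere2_spherical (theta phi : R) : sphere2 (spherical theta phi).
Proof.
rewrite /sphere2 /= /enorm !big_ord_recl big_ord0 !mxE /=.
transitivity (Num.sqrt (sin theta ^+ 2 * (cos phi ^+ 2 + sin phi ^+ 2)
  + cos theta ^+ 2) : R); first by congr Num.sqrt; ring.
by rewrite cos2Dsin2 mulr1 addrC cos2Dsin2 sqrtr1.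
Qed.

(** Bounding the density sin theta by 1, this is what takes the place of the
    area of the sphere in the estimates below. *)
Definition angle_measure : R :=
  fine ((lebesgue_measure \x lebesgue_measure)%E
    (`[0, pi] `*` `[0, 2 * pi] :
       set (measurableTypeR R * measurableTypeR R))).

Lemma normr_sphere_integralR_le (h : 'rV[R]_3 -> R) (K : R) :
  (forall xi, sphere2 xi -> `|h xi| <= K) ->
  `|sphere_integralR h| <= K * angle_measure.
Proof.
move=> hK; apply: normr_Rintegral_le => [||a _].
- exact: measurableX.
- have itv (b : R) : (lebesgue_measure `[0%R, b]%classic < +oo)%E.
    rewrite lebesgue_measure_itv /=.
    by case: ifP => _; rewrite ?ltry // -EFinB ltry.
  have E := @product_measure1E _ _ _ _ R lebesgue_measure lebesgue_measure
    `[0, pi]%classic `[0, 2 * pi]%classic (measurable_itv _) (measurable_itv _).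
  apply: (@eq_ind_r _ _ (fun z => z < +oo)%E _ _ E).
  by apply: lte_mul_pinfty; rewrite ?ge0_fin_numE ?itv //; exact: itv.
rewrite normrM -[leRHS]mulr1 ler_pM // ?hK //; first exact: sphere2_spherical.
by rewrite ler_norml sin_geN1 sin_le1.
Qed.

Lemma sphere_integralRZ (h : 'rV[R]_3 -> R) (k : R) : 0 < k ->
  sphere_integralR (fun xi => k * h xi) = k * sphere_integralR h.
Proof.
move=> k0; rewrite -RintegralZl_nomeas //; congr Rintegral.
by apply/funext => a; rewrite mulrA.
Qed.

Lemma fourier_coefZ g n m (k : R) : 0 < k ->
  fourier_coef (fun xi => k%:C%C * g xi) n m = k%:C%C * fourier_coef g n m.
Proof.
move=> k0; rewrite /fourier_coef /sphere_integral.
set Rf := fun xi => complex.Re _; set If := fun xi => complex.Im _.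
have -> : Rf = fun xi => k * complex.Re (g xi * (sph_harmonic n m xi)^*%C).
  apply/funext => xi; rewrite /Rf -mulrA [X in complex.Re X]mulrC.
  by rewrite Re_mul_real [RHS]mulrC.
have -> : If = fun xi => k * complex.Im (g xi * (sph_harmonic n m xi)^*%C).
  apply/funext => xi; rewrite /If -mulrA [X in complex.Im X]mulrC.
  by rewrite Im_mul_real [RHS]mulrC.
rewrite !sphere_integralRZ //.
by apply/eqP; rewrite eq_complex /= !mul0r subr0 addr0 !eqxx.
Qed.

Lemma fourier_laplaceZ p g (k : R) xi : 0 < k ->
  fourier_laplace p (fun xi => k%:C%C * g xi) xi
  = k%:C%C * fourier_laplace p g xi.
Proof.
move=> k0; rewrite /fourier_laplace /degree_order_sum mulr_sumr.
apply: eq_bigr => n _; rewrite mulr_sumr; apply: eq_bigr => m _.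
by rewrite fourier_coefZ // -mulrA.
Qed.

(** Compactness is what makes [supnorm] a genuine supremum here: the value of
    [sup] on an unbounded set is 0. *)
Lemma supnorm_ub (A : set 'rV[R]_3) (g : 'rV[R]_3 -> Cplx R) :
  compact A -> {within A, continuous g} ->
  forall x, A x -> Normc.normc (g x) <= supnorm A g.
Proof.
move=> cA cg x Ax; apply: ub_le_sup; last by exists x.
have cn : {within A, continuous (fun x => Normc.normc (g x) : R)}.
  by apply: within_continuous_comp cg => z _; exact: continuous_normc.
have [|y yA ymax] := EVT_max_rV _ cA cn; first by exists x.
by exists (Normc.normc (g y)) => _ [z Az <-]; apply: ymax; rewrite inE.
Qed.

(** The azimuth is discontinuous, but on the sphere a spherical harmonic agrees
    with a polynomial, which is bounded by compactness. *)
Lemma sph_harmonic_bounded n m : exists2 B : R, 0 <= B &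
  forall xi, sphere2 xi -> Normc.normc (sph_harmonic n m xi) <= B.
Proof.
have [K hK] := sph_harmonic_solid R n m.
have [[cRe cIm] _] := axes_harmonic_solid_poly R n m.
have csq : continuous (fun x : 'rV[R]_3 =>
    Normc.normc (solid_poly n m x) ^+ 2 : R).
  have -> : (fun x : 'rV[R]_3 => Normc.normc (solid_poly n m x) ^+ 2 : R)
    = (fun x => complex.Re (solid_poly n m x) * complex.Re (solid_poly n m x)
       + complex.Im (solid_poly n m x) * complex.Im (solid_poly n m x)).
    by apply/funext => x; rewrite normc2.
  by move=> x; exact: (cvgD (cvgM (cRe x) (cRe x)) (cvgM (cIm x) (cIm x))).
have [|y yS ymax] :=
  EVT_max_rV _ (@compact_sphere R 1) (continuous_subspaceT csq).
  by exists (spherical 0 0); exact: sphere2_spherical.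
exists (Normc.normc K * Normc.normc (solid_poly n m y)).
  by rewrite mulr_ge0 ?normc_ge0.
move=> xi xi1; rewrite (hK _ xi1) Normc.normcM.
apply: ler_wpM2l; first exact: normc_ge0.
have := ymax xi; rewrite inE => /(_ xi1).
by rewrite ler_pXn2r ?nnegrE ?normc_ge0.
Qed.

Lemma fourier_coef_bounded n m : exists2 B : R, 0 <= B &
  forall g (K : R), (forall xi, sphere2 xi -> Normc.normc (g xi) <= K) ->
  Normc.normc (fourier_coef g n m) <= B * K.
Proof.
have [B B0 hB] := sph_harmonic_bounded n m.
have A0 : 0 <= angle_measure by exact: fine_ge0.
exists (2 * (B * angle_measure)); first by rewrite !mulr_ge0.
move=> g K gK; have gYK xi : sphere2 xi ->
    Normc.normc (g xi * (sph_harmonic n m xi)^*%C) <= K * B.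
  move=> xi1; rewrite Normc.normcM normc_conjc.
  by apply: ler_pM; rewrite ?normc_ge0 ?gK ?hB.
apply: le_trans (normc_le_ReIm _) _.
have -> : 2 * (B * angle_measure) * K
  = K * B * angle_measure + K * B * angle_measure by ring.
apply: lerD; apply: normr_sphere_integralR_le => xi xi1;
  apply: le_trans (gYK xi xi1).
  exact: normr_Re_le.
exact: normr_Im_le.
Qed.

(** The sharp constant is the Lebesgue constant; a crude one is needed first, to
    see that the set defining the Lebesgue constant is bounded. *)
Lemma fourier_laplace_bounded p : exists B : R, forall g (K : R) xi,
  (forall eta, sphere2 eta -> Normc.normc (g eta) <= K) -> sphere2 xi ->
  Normc.normc (fourier_laplace p g xi) <= B * K.
Proof.
have /choice[B hB] (nm : nat * int) : exists B : R, forall g (K : R) xi,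
  (forall eta, sphere2 eta -> Normc.normc (g eta) <= K) -> sphere2 xi ->
  Normc.normc (fourier_coef g nm.1 nm.2 * sph_harmonic nm.1 nm.2 xi) <= B * K.
  case: nm => n m; have [C C0 hC] := fourier_coef_bounded n m.
  have [D D0 hD] := sph_harmonic_bounded n m.
  exists (C * D) => g K xi gK xi1.
  rewrite Normc.normcM mulrAC.
  by apply: ler_pM; rewrite ?normc_ge0 ?hC ?hD.
exists (\sum_(n < p.+1) \sum_(k < n.*2.+1) B (n : nat, k%:Z - n%:Z)).
move=> g K xi gK xi1; rewrite mulr_suml; apply: normc_sum_le => n.
rewrite mulr_suml; apply: normc_sum_le => k.
exact: (hB (n : nat, k%:Z - n%:Z)).
Qed.

Lemma fourier_laplace_le_lebesgue1 p (g : 'rV[R]_3 -> Cplx R) xi :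
  {within @sphere2 R, continuous g} -> supnorm (@sphere2 R) g <= 1 ->
  sphere2 xi -> Normc.normc (fourier_laplace p g xi) <= lebesgue_constant R p.
Proof.
move=> cg g1 xi1; have cS : compact (@sphere2 R) by exact: compact_sphere.
have [B hB] := fourier_laplace_bounded p.
have bound h eta : {within @sphere2 R, continuous h} ->
    supnorm (@sphere2 R) h <= 1 -> sphere2 eta ->
    Normc.normc (fourier_laplace p h eta) <= B * 1.
  move=> ch h1 eta1; apply: hB => // zeta zeta1.
  exact: le_trans (supnorm_ub cS ch zeta1) h1.
apply: (@le_trans _ _ (supnorm (@sphere2 R) (fourier_laplace p g))).
  apply: ub_le_sup; last by exists xi.
  by exists (B * 1) => _ [eta eta1 <-]; exact: bound.
apply: ub_le_sup; last by exists g.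
exists (B * 1) => _ [h [ch h1] <-].
apply: ge_sup => [|_ [eta eta1 <-]]; last exact: bound.
by exists (Normc.normc (fourier_laplace p h xi)), xi.
Qed.

Lemma lebesgue_constant_ge0 p : 0 <= lebesgue_constant R p.
Proof.
have c0 : {within @sphere2 R, continuous (fun=> 0 : Cplx R)}.
  by apply: continuous_subspaceT; exact: cst_continuous.
apply: le_trans (fourier_laplace_le_lebesgue1 p c0 _ (sphere2_spherical 0 0)).
  exact: normc_ge0.
apply: ge_sup; last by move=> _ [xi _ <-]; rewrite Normc.normc0.
exists (Normc.normc (0 : R[i])), (spherical 0 0) => //.
exact: sphere2_spherical.
Qed.

(** Normalize [g] by its norm.  When the norm is 0 this is impossible, but then
    the crude bound gives 0. *)
Lemma fourier_laplace_le_lebesgue p (g : 'rV[R]_3 -> Cplx R) xi :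
  {within @sphere2 R, continuous g} -> sphere2 xi ->
  Normc.normc (fourier_laplace p g xi)
  <= lebesgue_constant R p * supnorm (@sphere2 R) g.
Proof.
move=> cg xi1; have cS : compact (@sphere2 R) by exact: compact_sphere.
have gs := supnorm_ub cS cg.
set s := supnorm _ g in gs *.
have s0 : 0 <= s by apply: le_trans (gs _ xi1); exact: normc_ge0.
move: s0; rewrite le_eqVlt => /predU1P[s0|s0].
  have [B hB] := fourier_laplace_bounded p.
  by have := hB g s xi gs xi1; rewrite -s0 !mulr0.
have k0 : 0 < s^-1 by rewrite invr_gt0.
pose h : 'rV[R]_3 -> Cplx R := fun eta => (s^-1)%:C%C * g eta.
have ch : {within @sphere2 R, continuous h}.
  by move=> x; apply: cvgMl_tmp; exact: cg.
have normk : Normc.normc (s^-1)%:C%C = s^-1.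
  by rewrite /= expr0n addr0 sqrtr_sqr gtr0_norm.
have h1 eta : sphere2 eta -> Normc.normc (h eta) <= 1.
  by move=> eta1; rewrite /h Normc.normcM normk ler_pdivrMl ?mulr1 ?gs.
have sh : supnorm (@sphere2 R) h <= 1.
  apply: ge_sup => [|_ [eta eta1 <-]]; last exact: h1.
  by exists (Normc.normc (h xi)), xi.
have := fourier_laplace_le_lebesgue1 p ch sh xi1.
by rewrite fourier_laplaceZ // Normc.normcM normk ler_pdivrMl // mulrC.
Qed.

Lemma axes_harmonic_degree_order_sum p (a : nat -> int -> R[i]) :
  axes_harmonic (fun y : 'rV[R]_3 =>
    degree_order_sum p (fun n m => a n m * solid_harmonic n m y)).
Proof.
apply: axes_harmonic_sum => n; apply: axes_harmonic_sum => k.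
apply: axes_harmonicZ.
have [|K hK] := @solid_harmonic_solid R n (k%:Z - n%:Z).
  by have := ltn_ord k; lia.
rewrite (funext hK); apply: axes_harmonicZ; exact: axes_harmonic_solid_poly.
Qed.

Lemma local_expansion_sphere p c (rho : R) (f : 'rV[R]_3 -> Cplx R) y :
  0 < rho -> enorm y = rho ->
  degree_order_sum p (fun n m => local_coef c rho f n m * solid_harmonic n m y)
  = fourier_laplace p (fun xi => f (c + rho *: xi)) (rho^-1 *: y).
Proof.
move=> rho0 yr; apply: eq_bigr => n _; apply: eq_bigr => k _.
rewrite /local_coef /solid_harmonic yr mulrACA -rmorphM mulVf ?mul1r //.
by rewrite expf_neq0 // gt_eqF.
Qed.

Lemma within_sphere_dilation c (rho : R) (f : 'rV[R]_3 -> Cplx R) :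
  0 < rho -> {within ecball c rho, continuous f} ->
  {within @sphere2 R, continuous (fun xi => f (c + rho *: xi) : Cplx R)}.
Proof.
move=> rho0 /subspace_continuousP cf; apply/subspace_continuousP => xi xi1.
have aS eta : sphere2 eta -> ecball c rho (c + rho *: eta).
  move=> eta1; rewrite /ecball /= addrC addKr.
  by rewrite enormZ ?(ltW rho0) // eta1 mulr1.
have ca : (fun eta => c + rho *: eta) @ xi --> c + rho *: xi.
  have cZ : (fun eta : 'rV[R]_3 => rho *: eta) @ xi --> rho *: xi.
    exact: (@cvgZl_tmp R _ _ (nbhs xi) _ rho id xi (@cvg_id _ _)).
  exact: (cvgD (@cvg_cst _ c _ (nbhs xi) _) cZ).
move=> W hW; have fW : nbhs (c + rho *: xi)
    [set z | ecball c rho z -> W (f z)] := cf _ (aS _ xi1) _ hW.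
have gW : nbhs xi [set eta | ecball c rho (c + rho *: eta) ->
    W (f (c + rho *: eta))] := ca _ fW.
have FF : Filter (nbhs xi) by exact: nbhs_filter.
exact: (@filterS _ _ FF _ _ (fun eta h eta1 => h (aS eta eta1)) gW).
Qed.
End SphereOperators.

(** * The local expansion in the supremum norm *)

Theorem lemma3p2 (R : realType) (p : nat) (rho : R) (c : 'rV[R]_3)
    (f : 'rV[R]_3 -> Cplx R)
    (rho_gt0 : 0 < rho)
    (f_harmonic : harmonic_on (eball c rho) f)
    (f_continuous : {within ecball c rho, continuous f}) :
  supnorm (ecball c rho) (local_expansion p c rho f)
  <= lebesgue_constant R p * supnorm (ecball c rho) f.
Proof.
pose g : 'rV[R]_3 -> Cplx R := fun xi => f (c + rho *: xi).
have cg : {within @sphere2 R, continuous g} by exact: within_sphere_dilation.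
have cc : ecball c rho c by rewrite /ecball /= subrr enorm0 ltW.
have gf : supnorm (@sphere2 R) g <= supnorm (ecball c rho) f.
  apply: ge_sup => [|_ [xi xi1 <-]].
    exists (Normc.normc (g (spherical 0 0))), (spherical 0 0) => //.
    exact: sphere2_spherical.
  apply: supnorm_ub f_continuous _ _; first exact: compact_ecball.
  by rewrite /ecball /= addrC addKr enormZ ?(ltW rho_gt0) // xi1 mulr1.
apply: ge_sup; first by exists (Normc.normc (local_expansion p c rho f c)), c.
move=> _ [x xr <-].
have uh := axes_harmonic_degree_order_sum p (local_coef c rho f).
apply: (maximum_principle rho_gt0 uh _ xr).
move=> y yr; rewrite local_expansion_sphere //.
apply: (@le_trans _ _ (lebesgue_constant R p * supnorm (@sphere2 R) g)).
  apply: fourier_laplace_le_lebesgue => //.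
  by rewrite /sphere2 /= enormZ ?invr_ge0 ?(ltW rho_gt0) // yr mulVf ?gt_eqF.
exact: ler_wpM2l (lebesgue_constant_ge0 R p) _ _ gf.
Qed.
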